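(* Let $A$ be a Noetherian admissible ring with ideal of definition generated by a single element $a$, and let $R=A[a^{1/p},a^{1/p^2},\ldots]$ (so $R$ is $\mathrm{eka}^p$). Then the ring $R[T^{1/p^\infty}]$ is coherent.
   Context: All rings are commutative; $p\ge2$ is a fixed integer (not necessarily prime). A linearly topologized ring is admissible if it is separated and complete and has an ideal of definition, i.e. an open ideal $J$ such that every neighborhood $V$ of $0$ contains some $J^n$. The $\mathrm{eka}^p$ ring $R=A[a^{1/p},a^{1/p^2},\ldots]$ is $\varinjlim_i A[X]/(X^{p^i}-a)$, obtained from $A$ by successively attaching $p$-th power roots of $a$; it is assumed that $a$ has no fractional powers in $A$ (no root $a^{1/p^i}$, $i\ge 1$, of $a$ lies in $A$) and that $(a)$ is the prescribed maximal ideal of definition of $A$. $R[T^{1/p^\infty}]:=\bigcup_{i\ge0}R[T^{1/p^i}]$. A ring is coherent if each of its finitely generated ideals is finitely presented. *)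

(* Defs.v *)
From HB Require Import structures.
From mathcomp Require Import all_boot all_order all_algebra.
From mathcomp Require Import generic_quotient qpoly.
From mathcomp Require Import mathcomp_extra boolp classical_sets topology tvs.

Set Implicit Arguments.
Unset Strict Implicit.
Unset Printing Implicit Defensive.

Import GRing.Theory.
Local Open Scope ring_scope.
Local Open Scope classical_set_scope.
Local Open Scope quotient_scope.

Definition submodule (R : comNzRingType) (V : lmodType R) (N : set V) : Prop :=
  GRing.submod_closed [in N].

Lemma submoduleP (R : comNzRingType) (V : lmodType R) (N : set V) :
  submodule N <->
  [/\ N 0, forall x y, N x -> N y -> N (x + y) &
      forall (r : R) x, N x -> N (r *: x)].
Proof.
split=> [[N0 Nlin]|[N0 ND NZ]].
  have {}N0 : N 0 by rewrite inE in N0.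
  have {}Nlin r x y : N x -> N y -> N (r *: x + y).
    by move=> Nx Ny; have := Nlin r x y (mem_set Nx) (mem_set Ny); rewrite inE.
  split=> // [x y Nx Ny|r x Nx]; first by rewrite -[x]scale1r; apply: Nlin.
  by rewrite -[_ *: _]addr0; apply: Nlin.
split=> [|r x y]; first exact: mem_set.
by rewrite !inE => Nx Ny; apply: ND => //; apply: NZ.
Qed.

Definition span_of (R : comNzRingType) (V : lmodType R) n (x : 'I_n -> V) :
  set V := [set v | exists c : 'I_n -> R, v = \sum_(i < n) c i *: x i].

Definition fin_generated (R : comNzRingType) (V : lmodType R) (N : set V) :
  Prop := exists (n : nat) (x : 'I_n -> V), N = span_of x.

(* A linear map R^n -> V with image N is a surjection R^n -> N with the same
   kernel. *)
Definition fin_presented (R : comNzRingType) (V : lmodType R) (N : set V) :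
  Prop := exists (n : nat) (phi : {linear 'rV[R]_n -> V}),
    range phi = N /\ fin_generated (phi @^-1` [set 0]).

Definition ideal (R : comNzRingType) (I : set R) : Prop :=
  @submodule R R^o I.

Definition noetherian (R : comNzRingType) : Prop :=
  forall I : set R, ideal I -> @fin_generated R R^o I.

Definition coherent (R : comNzRingType) : Prop :=
  forall I : set R, ideal I -> @fin_generated R R^o I -> @fin_presented R R^o I.

Definition principal (R : comNzRingType) (a : R) : set R :=
  @span_of R R^o 1 (fun=> a).

Definition ideal_mul (R : comNzRingType) (I J : set R) : set R :=
  [set x | exists (n : nat) (u v : 'I_n -> R),
     [/\ forall i, I (u i), forall i, J (v i) & x = \sum_(i < n) u i * v i]].

Fixpoint ideal_exp (R : comNzRingType) (J : set R) (n : nat) : set R :=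
  if n is m.+1 then ideal_mul J (ideal_exp J m) else setT.

(* The topology of a [UniformZmodule] determines its uniformity, which is the
   one for which completeness of a topological ring is meant. *)

HB.mixin Record UniformZmodule_isTopRing A
    of UniformZmodule A & GRing.ComNzRing A := {
  mul_continuous : continuous (fun x : A * A => x.1 * x.2)
}.

#[short(type="topComRingType")]
HB.structure Definition TopComRing :=
  {A of UniformZmodule A & GRing.ComNzRing A & UniformZmodule_isTopRing A}.

Definition linearly_topologized (A : topComRingType) : Prop :=
  forall V : set A, nbhs (0 : A) V ->
    exists I : set A, [/\ ideal I, open I & I `<=` V].

Definition complete_space (T : uniformType) : Prop :=
  forall F : set_system T, ProperFilter F -> cauchy F ->
    exists x : T, F --> x.

Definition ideal_of_definition (A : topComRingType) (J : set A) : Prop :=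
  [/\ ideal J, open J &
   forall V : set A, nbhs (0 : A) V -> exists n, ideal_exp J n `<=` V].

Definition admissible (A : topComRingType) : Prop :=
  [/\ linearly_topologized A, hausdorff_space A, complete_space A &
   exists J : set A, ideal_of_definition J].

Definition max_ideal_of_definition (A : topComRingType) (J : set A) : Prop :=
  ideal_of_definition J /\
  forall J' : set A, ideal_of_definition J' -> J `<=` J' -> J' = J.

(* Direct limit of R 0 -> R 1 -> R 2 -> ... : the disjoint union of the R i,
   two elements being identified when they agree in some R n. *)

Section DirectLimit.
Variables (R : nat -> comNzRingType) (f : forall i, {rmorphism R i -> R i.+1}).

(* The image of u in R n when tag u <= n, and 0 otherwise. *)
Fixpoint dirlim_push (u : {i & R i}) (n : nat) : R n :=
  match n with
  | 0 => untag (0 : R 0) id u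
  | m.+1 => untag (f m (dirlim_push u m)) id u
  end.

Lemma dirlim_pushE i (x : R i) : dirlim_push (Tagged R x) i = x.
Proof.
by case: i x => [|i] x /=; rewrite /untag; case: eqP => // e;
  rewrite (eq_irrelevance e (erefl _)).
Qed.

Lemma dirlim_pushS u n : (tag u <= n)%N ->
  dirlim_push u n.+1 = f n (dirlim_push u n).
Proof. by move=> le; rewrite /= untag_dflt // neq_ltn ltnS le. Qed.

Lemma dirlim_ind (P : nat -> Prop) i : P i ->
  (forall n, (i <= n)%N -> P n -> P n.+1) -> forall n, (i <= n)%N -> P n.
Proof.
move=> Pi PS; elim=> [|n IH]; first by rewrite leqn0 => /eqP <-.
rewrite leq_eqVlt => /orP[/eqP <-//|]; rewrite ltnS => le.
by apply: PS => //; apply: IH.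
Qed.

Definition dirlim_rel (u v : {i & R i}) : bool :=
  `[< exists n, [/\ (tag u <= n)%N, (tag v <= n)%N &
                    dirlim_push u n = dirlim_push v n] >].

Lemma dirlim_push_stable u v n m : (tag u <= n)%N -> (tag v <= n)%N ->
  dirlim_push u n = dirlim_push v n -> (n <= m)%N ->
  dirlim_push u m = dirlim_push v m.
Proof.
move=> un vn e; move: m; apply: dirlim_ind => // m nm IH.
by rewrite !dirlim_pushS ?IH // (leq_trans _ nm).
Qed.

Lemma dirlim_rel_refl : reflexive dirlim_rel.
Proof. by move=> u; apply/asboolP; exists (tag u). Qed.

Lemma dirlim_rel_sym : symmetric dirlim_rel.
Proof.
by move=> u v; apply/asboolP/asboolP => -[n [un vn e]]; exists n; split.
Qed.

Lemma dirlim_rel_trans : transitive dirlim_rel.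
Proof.
move=> v u w /asboolP[n [un vn e]] /asboolP[m [vm wm e']].
apply/asboolP; exists (maxn n m).
have nM := leq_maxl n m; have mM := leq_maxr n m.
split; [exact: leq_trans nM|exact: leq_trans mM|].
by rewrite (dirlim_push_stable un vn e nM) (dirlim_push_stable vm wm e' mM).
Qed.

Canonical dirlim_equiv :=
  EquivRel dirlim_rel dirlim_rel_refl dirlim_rel_sym dirlim_rel_trans.

Definition dirlim : Type := {eq_quot dirlim_equiv}.

HB.instance Definition _ := Choice.on dirlim.

Definition dirlim_in i (x : R i) : dirlim :=
  \pi_({eq_quot dirlim_equiv}) (Tagged R x).

Definition dirlim_op (op : forall n, R n -> R n -> R n) (x y : dirlim) :
    dirlim :=
  let u := repr x in let v := repr y in
  let n := maxn (tag u) (tag v) in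
  dirlim_in (op n (dirlim_push u n) (dirlim_push v n)).

Definition dirlim_add := dirlim_op (fun n => +%R).
Definition dirlim_mul := dirlim_op (fun n => *%R).
Definition dirlim_opp (x : dirlim) : dirlim :=
  dirlim_in (- tagged (repr x)).
Definition dirlim_zero : dirlim := dirlim_in (0 : R 0).
Definition dirlim_one : dirlim := dirlim_in (1 : R 0).

Lemma dirlim_piP (u v : {i & R i}) :
  \pi_({eq_quot dirlim_equiv}) u = \pi_({eq_quot dirlim_equiv}) v <->
  exists n, [/\ (tag u <= n)%N, (tag v <= n)%N &
                dirlim_push u n = dirlim_push v n].
Proof. by split=> [/eqmodP/asboolP|h]; [|apply/eqmodP/asboolP]. Qed.

Lemma dirlim_in_eq i (x y : R i) : dirlim_in x = dirlim_in y <->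
  exists n, (i <= n)%N /\
    dirlim_push (Tagged R x) n = dirlim_push (Tagged R y) n.
Proof.
split=> [/dirlim_piP[n [le _ e]]|[n [le e]]]; first by exists n.
by apply/dirlim_piP; exists n.
Qed.

Lemma dirlim_in_step i (x : R i) : dirlim_in (f i x) = dirlim_in x.
Proof.
apply/dirlim_piP; exists i.+1; split; [exact: leqnn|exact: leqnSn|].
by rewrite [RHS]dirlim_pushS // !dirlim_pushE.
Qed.

Lemma dirlim_in_push u n : (tag u <= n)%N ->
  dirlim_in (dirlim_push u n) = \pi_({eq_quot dirlim_equiv}) u.
Proof.
by move=> un; apply/dirlim_piP; exists n; split=> //; rewrite dirlim_pushE.
Qed.

Lemma dirlim_in_repr (x : dirlim) n : (tag (repr x) <= n)%N ->
  dirlim_in (dirlim_push (repr x) n) = x.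
Proof. by move=> xn; rewrite dirlim_in_push // reprK. Qed.

Lemma dirlim_in_surj (x : dirlim) : exists i (y : R i), x = dirlim_in y.
Proof.
by exists (tag (repr x)), (dirlim_push (repr x) _); rewrite dirlim_in_repr.
Qed.

Lemma dirlim_in_surj3 (x y z : dirlim) : exists i (x' y' z' : R i),
  [/\ x = dirlim_in x', y = dirlim_in y' & z = dirlim_in z'].
Proof.
pose n := maxn (tag (repr x)) (maxn (tag (repr y)) (tag (repr z))).
exists n, (dirlim_push (repr x) n), (dirlim_push (repr y) n),
  (dirlim_push (repr z) n).
by rewrite !dirlim_in_repr // /n !leq_max leqnn ?orbT.
Qed.

Lemma dirlim_pushF (op : forall n, R n -> R n -> R n) u v w n m :
  (forall k x y, f k (op k x y) = op k.+1 (f k x) (f k y)) ->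
  (tag u <= n)%N -> (tag v <= n)%N -> (tag w <= n)%N ->
  dirlim_push w n = op n (dirlim_push u n) (dirlim_push v n) -> (n <= m)%N ->
  dirlim_push w m = op m (dirlim_push u m) (dirlim_push v m).
Proof.
move=> fop un vn wn e; move: m; apply: dirlim_ind => // m nm IH.
by rewrite !dirlim_pushS ?(leq_trans _ nm) // IH fop.
Qed.

Lemma dirlim_opE (op : forall n, R n -> R n -> R n) i (x y : R i) :
  (forall k x y, f k (op k x y) = op k.+1 (f k x) (f k y)) ->
  dirlim_op op (dirlim_in x) (dirlim_in y) = dirlim_in (op i x y).
Proof.
move=> fop; rewrite /dirlim_op.
set u := repr (dirlim_in x); set v := repr (dirlim_in y).
set k := maxn (tag u) (tag v).
have uk : (tag u <= k)%N := leq_maxl _ _.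
have vk : (tag v <= k)%N := leq_maxr _ _.
have /dirlim_piP[n [un xn eu]] :
  \pi_({eq_quot dirlim_equiv}) u = \pi_({eq_quot dirlim_equiv}) (Tagged R x).
  by rewrite reprK.
have /dirlim_piP[m [vm ym ev]] :
  \pi_({eq_quot dirlim_equiv}) v = \pi_({eq_quot dirlim_equiv}) (Tagged R y).
  by rewrite reprK.
pose l := maxn k (maxn n m).
have kl : (k <= l)%N := leq_maxl _ _.
have nl : (n <= l)%N by rewrite /l !leq_max leqnn orbT.
have ml : (m <= l)%N by rewrite /l !leq_max leqnn !orbT.
have il : (i <= l)%N := leq_trans xn nl.
apply/dirlim_piP; exists l; split=> //.
rewrite (dirlim_pushF fop uk vk _ _ kl) ?dirlim_pushE //.
rewrite (@dirlim_pushF op (Tagged R x) (Tagged R y) (Tagged R (op i x y)) i) //;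
  last by rewrite !dirlim_pushE.
by rewrite (dirlim_push_stable un xn eu nl) (dirlim_push_stable vm ym ev ml).
Qed.

Lemma dirlim_in_add i (x y : R i) :
  dirlim_add (dirlim_in x) (dirlim_in y) = dirlim_in (x + y).
Proof. by apply: dirlim_opE => k ? ?; rewrite rmorphD. Qed.

Lemma dirlim_in_mul i (x y : R i) :
  dirlim_mul (dirlim_in x) (dirlim_in y) = dirlim_in (x * y).
Proof. by apply: dirlim_opE => k ? ?; rewrite rmorphM. Qed.

Lemma dirlim_in_zero i : dirlim_zero = dirlim_in (0 : R i).
Proof.
by elim: i => // i ->; rewrite -dirlim_in_step rmorph0.
Qed.

Lemma dirlim_in_one i : dirlim_one = dirlim_in (1 : R i).
Proof.
by elim: i => // i ->; rewrite -dirlim_in_step rmorph1.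
Qed.

Lemma dirlim_addA : associative dirlim_add.
Proof.
move=> x y z; have [i [x' [y' [z' [-> -> ->]]]]] := dirlim_in_surj3 x y z.
by rewrite !dirlim_in_add addrA.
Qed.

Lemma dirlim_addC : commutative dirlim_add.
Proof.
move=> x y; have [i [x' [y' [_ [-> -> _]]]]] := dirlim_in_surj3 x y y.
by rewrite !dirlim_in_add addrC.
Qed.

Lemma dirlim_add0 : left_id dirlim_zero dirlim_add.
Proof.
move=> x; have [i [x' ->]] := dirlim_in_surj x.
by rewrite (dirlim_in_zero i) dirlim_in_add add0r.
Qed.

Lemma dirlim_addN : left_inverse dirlim_zero dirlim_opp dirlim_add.
Proof.
move=> x; rewrite -{2}[x](dirlim_in_repr (leqnn _)) /dirlim_opp.
rewrite dirlim_in_add (dirlim_in_zero (tag (repr x))).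
by case: (repr x) => i y; rewrite dirlim_pushE addNr.
Qed.

HB.instance Definition _ := GRing.isZmodule.Build dirlim
  dirlim_addA dirlim_addC dirlim_add0 dirlim_addN.

Lemma dirlim_mulA : associative dirlim_mul.
Proof.
move=> x y z; have [i [x' [y' [z' [-> -> ->]]]]] := dirlim_in_surj3 x y z.
by rewrite !dirlim_in_mul mulrA.
Qed.

Lemma dirlim_mulC : commutative dirlim_mul.
Proof.
move=> x y; have [i [x' [y' [_ [-> -> _]]]]] := dirlim_in_surj3 x y y.
by rewrite !dirlim_in_mul mulrC.
Qed.

Lemma dirlim_mul1 : left_id dirlim_one dirlim_mul.
Proof.
move=> x; have [i [x' ->]] := dirlim_in_surj x.
by rewrite (dirlim_in_one i) dirlim_in_mul mul1r.
Qed.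

Lemma dirlim_mulDl : left_distributive dirlim_mul dirlim_add.
Proof.
move=> x y z; have [i [x' [y' [z' [-> -> ->]]]]] := dirlim_in_surj3 x y z.
by rewrite !(dirlim_in_add, dirlim_in_mul) mulrDl.
Qed.

Lemma dirlim_one_neq0 : dirlim_one != dirlim_zero.
Proof.
apply/eqP => /dirlim_in_eq[n [_]].
have -> : dirlim_push (Tagged R (1 : R 0)) n = 1.
  apply: (@dirlim_ind (fun n => dirlim_push (Tagged R (1 : R 0)) n = 1) 0) => //.
    by rewrite dirlim_pushE.
  by move=> m _ e; rewrite dirlim_pushS // e rmorph1.
have -> : dirlim_push (Tagged R (0 : R 0)) n = 0.
  apply: (@dirlim_ind (fun n => dirlim_push (Tagged R (0 : R 0)) n = 0) 0) => //.
    by rewrite dirlim_pushE.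
  by move=> m _ e; rewrite dirlim_pushS // e rmorph0.
by move/eqP; rewrite oner_eq0.
Qed.

HB.instance Definition _ := GRing.Zmodule_isComNzRing.Build dirlim
  dirlim_mulA dirlim_mulC dirlim_mul1 dirlim_mulDl dirlim_one_neq0.

Lemma dirlim_in_is_zmod_morphism i : zmod_morphism (@dirlim_in i).
Proof.
move=> x y; apply/eqP; rewrite eq_sym subr_eq; apply/eqP.
by rewrite [RHS]dirlim_in_add subrK.
Qed.

Lemma dirlim_in_is_monoid_morphism i : monoid_morphism (@dirlim_in i).
Proof.
by split=> [|x y]; [rewrite -dirlim_in_one | rewrite -dirlim_in_mul].
Qed.

HB.instance Definition _ i := GRing.isZmodMorphism.Build (R i) dirlim
  (@dirlim_in i) (@dirlim_in_is_zmod_morphism i).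
HB.instance Definition _ i := GRing.isMonoidMorphism.Build (R i) dirlim
  (@dirlim_in i) (@dirlim_in_is_monoid_morphism i).

End DirectLimit.

(* The class of 'X at stage i is the root a^(1/p^i); it is sent to the p-th
   power of the root at stage i.+1. *)

Section Eka.
Variables (A : comNzRingType) (a : A) (p : nat) (p_gt1 : (1 < p)%N).

Definition root_poly (i : nat) : {poly A} := 'X^(p ^ i) - a%:P.

Definition root_ring (i : nat) : comNzRingType := {poly %/ root_poly i}.

Let pi_gt0 i : (0 < p ^ i)%N.
Proof. by rewrite expn_gt0 (ltn_trans _ p_gt1). Qed.

(* [{poly %/ h}] is the quotient by mk_monic h. *)
Lemma mk_monic_root_poly i : mk_monic (root_poly i) = root_poly i.
Proof.
rewrite /mk_monic /root_poly size_XnsubC // ltnS pi_gt0 /=.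
by rewrite monicXnsubC.
Qed.

Lemma root_poly_step i : root_poly i \Po 'X^p = root_poly i.+1.
Proof.
by rewrite /root_poly comp_polyB comp_polyC comp_Xn_poly -exprM expnS.
Qed.

(* The unused proof of 1 < p lets the morphism instances below be inferred; for
   p = 0 this map need not be multiplicative. *)
Definition root_step (_ : (1 < p)%N) (i : nat) (q : root_ring i) :
  root_ring i.+1 := in_qpoly (root_poly i.+1) ((q : {poly A}) \Po 'X^p).

Lemma root_step_in_qpoly i (q : {poly A}) :
  root_step p_gt1 (in_qpoly (root_poly i) q) =
  in_qpoly (root_poly i.+1) (q \Po 'X^p).
Proof.
rewrite /root_step /=.
rewrite [in RHS](Pdiv.RingMonic.rdivp_eq (monic_mk_monic (root_poly i)) q).
rewrite [in RHS]mk_monic_root_poly comp_polyD comp_polyM root_poly_step.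
rewrite rmorphD rmorphM /=.
suff -> : in_qpoly (root_poly i.+1) (root_poly i.+1) = 0.
  by rewrite mulr0 add0r mk_monic_root_poly.
apply: val_inj => /=; rewrite mk_monic_root_poly -{1}[root_poly i.+1]mul1r.
by rewrite Pdiv.RingMonic.rmodp_mull // monicXnsubC ?pi_gt0.
Qed.

Lemma root_step_is_zmod_morphism i : zmod_morphism (@root_step p_gt1 i).
Proof. by move=> x y; rewrite /root_step -raddfB -comp_polyB. Qed.

Lemma root_step_is_monoid_morphism i : monoid_morphism (@root_step p_gt1 i).
Proof.
split=> [|x y].
  by rewrite /root_step /= comp_polyC rmorph1.
by rewrite root_step_in_qpoly comp_polyM rmorphM.
Qed.

HB.instance Definition _ i := GRing.isZmodMorphism.Build
  (root_ring i) (root_ring i.+1) (@root_step p_gt1 i)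
  (@root_step_is_zmod_morphism i).
HB.instance Definition _ i := GRing.isMonoidMorphism.Build
  (root_ring i) (root_ring i.+1) (@root_step p_gt1 i)
  (@root_step_is_monoid_morphism i).

Definition eka : comNzRingType := dirlim (fun i : nat =>
  root_step p_gt1 (i := i) : {rmorphism root_ring i -> root_ring i.+1}).

End Eka.

(* Stage i is R[T^(1/p^i)], a polynomial ring in 'X = T^(1/p^i); the inclusion
   into R[T^(1/p^(i+1))] is 'X |-> 'X^p. *)

Definition perf_poly (R : comNzRingType) (p : nat) : comNzRingType :=
  @dirlim (fun=> {poly R}) (fun=> comp_poly ('X^p : {poly R})).

(* Main.v *)
(* The ring is the union of the stages B_i = A[X]/(X^(p^i) - a)[T^(1/p^i)].
   Each B_i is Noetherian by Hilbert's basis theorem, and B_(i+1) is a finite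
   free B_i-module with basis the products of a^(u/p^(i+1)) and T^(v/p^(i+1)),
   u, v < p.  A finite family of elements lives in some B_i, where its syzygies
   are finitely generated; taking coordinates, any syzygy over a later stage is
   a combination of syzygies over B_i. *)

Require Import Defs.
From HB Require Import structures.
From mathcomp Require Import all_boot all_order all_algebra.
From mathcomp Require Import qpoly.
From mathcomp Require Import boolp classical_sets topology.

Set Implicit Arguments.
Unset Strict Implicit.
Unset Printing Implicit Defensive.

Import GRing.Theory.
Local Open Scope ring_scope.

(** * Finite generation, and submodules of free modules over a Noetherian ring *)

Lemma submodule_sum (R : comNzRingType) (V : lmodType R) (N : set V)
    (L : finType) (c : L -> R) (x : L -> V) :
  submodule N -> (forall l, N (x l)) -> N (\sum_l c l *: x l).
Proof.
by move=> /submoduleP[N0 ND NZ] Nx; apply: big_ind => // l _; apply: NZ.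
Qed.

Lemma span_of_mem (R : comNzRingType) (V : lmodType R) n (x : 'I_n -> V) j :
  span_of x (x j).
Proof.
exists (fun i => (i == j)%:R); rewrite (bigD1 j) //= eqxx scale1r.
by rewrite big1 ?addr0 // => i /negPf->; rewrite scale0r.
Qed.

Lemma fin_generated_by (R : comNzRingType) (V : lmodType R) (N : set V)
    (L : finType) (x : L -> V) :
  submodule N -> (forall l, N (x l)) ->
  (forall v, N v -> exists c : L -> R, v = \sum_l c l *: x l) ->
  fin_generated N.
Proof.
move=> Nsub Nx Ngen; exists #|L|, (fun i => x (enum_val i)).
apply/seteqP; split=> [v /Ngen[c ->]|_ [c ->]]; last exact: submodule_sum.
exists (fun i => c (enum_val i)).
by rewrite (big_enum_val (fun l => c l *: x l)).
Qed.

(** Induction on [n]: the first coordinates of rows in [N] form an ideal [J], and the rows with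
    first coordinate zero give a submodule [K] of smaller rank. Lifts of generators of [J], together
    with generators of [K], generate [N]. *)
Lemma noetherian_row_submodule (R : comNzRingType) (n : nat)
    (N : set 'rV[R]_n) :
  noetherian R -> submodule N -> fin_generated N.
Proof.
move=> Rnoeth; elim: n N => [|n IH] N Nsub.
  apply: (@fin_generated_by _ _ _ 'I_0 (fun=> 0)) => // [l|v _].
    by have /submoduleP[] := Nsub.
  by exists (fun=> 0); rewrite big_ord0 [v]thinmx0.
have /submoduleP[N0 ND NZ] := Nsub.
pose J : set R := fun r => exists2 v, N v & v 0 0 = r.
pose K : set 'rV[R]_n := fun w => N (row_mx (0 : 'rV_1) w).
have Jsub : ideal J.
  apply/submoduleP; split=> [|_ _ [v Nv <-] [w Nw <-]|r _ [v Nv <-]].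
  - by exists 0; rewrite ?mxE.
  - by exists (v + w); [exact: ND|rewrite mxE].
  - by exists (r *: v); [exact: NZ|rewrite mxE].
have Ksub : submodule K.
  rewrite /K; apply/submoduleP; split=> [|v w Kv Kw|r v Kv].
  - by rewrite row_mx0.
  - by rewrite -[0]addr0 -add_row_mx; apply: ND.
  - by rewrite -[0](scaler0 _ r) -scale_row_mx; apply: NZ.
have [m [c Jc]] := Rnoeth _ Jsub; have [k [w Kw]] := IH _ Ksub.
have Jmem j : J (c j) by rewrite Jc; exact: (span_of_mem (V := R^o)).
have Kmem j : K (w j) by rewrite Kw; exact: span_of_mem.
pose v j : 'rV[R]_(n.+1) := s2val (cid2 (Jmem j)).
have Nv j : N (v j) by exact: (s2valP (cid2 (Jmem j))).
have vE j : v j 0 0 = c j by exact: (s2valP' (cid2 (Jmem j))).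
pose x (l : 'I_m + 'I_k) : 'rV[R]_(n.+1) :=
  match l with inl j => v j | inr j => row_mx (0 : 'rV_1) (w j) end.
apply: (@fin_generated_by _ _ _ _ x) => // [[j|j]|u Nu] /=.
- exact: Nv.
- exact: Kmem.
have [r ur] : (span_of c : set R^o) (u 0 0) by rewrite -Jc; exists u.
pose u' := u - \sum_j r j *: v j.
have Nu' : N u'.
  by apply: ND => //; rewrite -scaleN1r; apply: NZ; apply: submodule_sum.
have u'E : u' = row_mx (0 : 'rV_1) (rsubmx (u' : 'rV_(1 + n))).
  apply: etrans (esym (@hsubmxK _ 1 1 n u')) _; congr row_mx.
  apply/rowP => i; rewrite ord1 !mxE.
  have -> : lshift n (0 : 'I_1) = 0 by apply: val_inj.
  rewrite ur summxE; apply/eqP; rewrite subr_eq0; apply/eqP.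
  by apply: eq_bigr => j _; rewrite mxE vE.
have [s su] : span_of w (rsubmx (u' : 'rV_(1 + n))).
  by rewrite -Kw /K -u'E.
exists (fun l => match l with inl j => r j | inr j => s j end).
rewrite big_sumType /= -[u](subrK (\sum_j r j *: v j)) addrC; congr (_ + _).
rewrite -/u' u'E su; apply/esym/(etrans (esym (@hsubmxK _ 1 1 n _))).
congr row_mx.
  rewrite linear_sum /= big1 // => j _; rewrite linearZ /= row_mxKl scaler0 //.
by rewrite linear_sum; apply: eq_bigr => j _; rewrite linearZ /= row_mxKr.
Qed.

(** * Noetherian polynomial rings and quotients *)

Lemma size_XnM_leq (R : comNzRingType) k n (q : {poly R}) :
  (size q <= n)%N -> (size ('X^k * q)%R <= k + n)%N.
Proof.
move=> sq; rewrite (leq_trans (size_polyMleq _ _)) // size_polyXn addSn /=.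
by rewrite leq_add2l.
Qed.

(* Hilbert's basis theorem. One leading-coefficient ideal J, taken over all
   degrees at once, reduces I to its elements of size at most D, which form a
   submodule of R^D. *)
Lemma noetherian_poly (R : comNzRingType) :
  noetherian R -> noetherian {poly R}.
Proof.
move=> Rnoeth I Isub; have /submoduleP[I0 ID IM] := Isub.
(* The coefficient in degree [d] may vanish, so zero and cancelling sums need no separate case. *)
pose J : set R := fun r => exists d (q : {poly R}),
  [/\ I q, (size q <= d.+1)%N & q`_d = r].
have Jsub : ideal J.
  apply/submoduleP; split.
  - by exists 0%N, 0; split; rewrite ?size_poly0 ?coef0.
  - move=> _ _ [d [q [Iq sq <-]]] [d' [q' [Iq' sq' <-]]].
    (* The crossed shifts put both top coefficients in degree [d + d'], where they add. *)
    exists (d + d')%N, ('X^d' * q + 'X^d * q'); split.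
    + by apply: ID; apply: IM.
    + rewrite (leq_trans (size_polyD _ _)) // geq_max.
      rewrite -{2}addnS size_XnM_leq // andbT addnC -addnS.
      exact: size_XnM_leq.
    by rewrite coefD !coefXnM !ltnNge leq_addl leq_addr /= addnK addKn.
  - move=> r _ [d [q [Iq sq <-]]]; exists d, (r *: q); split.
    + by rewrite -mul_polyC; apply: IM.
    + exact: leq_trans (size_scale_leq _ _) sq.
    + by rewrite coefZ.
have [m [c Jc]] := Rnoeth _ Jsub.
have Jmem j : J (c j) by rewrite Jc; exact: (span_of_mem (V := R^o)).
pose d j := projT1 (cid (Jmem j)).
pose f0 j := projT1 (cid (projT2 (cid (Jmem j)))).
have f0P j : [/\ I (f0 j), (size (f0 j) <= (d j).+1)%N & (f0 j)`_(d j) = c j].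
  exact: (projT2 (cid (projT2 (cid (Jmem j))))).
(* Shifting each [f0 j] realises all generators of [J] in one common degree [D]. *)
pose D := \max_j d j.
have dD j : (d j <= D)%N by exact: leq_bigmax.
pose f j : {poly R} := 'X^(D - d j) * f0 j.
have If j : I (f j) by have [If0 _ _] := f0P j; apply: IM.
have sf j : (size (f j) <= D.+1)%N.
  have [_ sf0 _] := f0P j.
  by rewrite -(subnK (dD j)) -addnS size_XnM_leq.
have fD j : (f j)`_D = c j.
  have [_ _ <-] := f0P j.
  by rewrite coefXnM ltnNge leq_subr /= subKn.
pose N : set 'rV[R]_D := fun v => I (rVpoly v).
have Nsub : submodule N.
  rewrite /N; apply/submoduleP; split=> [|v w Nv Nw|r v Nv].
  - by rewrite linear0.
  - by rewrite linearD; apply: ID.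
  - by rewrite linearZ /= -mul_polyC; apply: IM.
have [k [w Nw]] := noetherian_row_submodule Rnoeth Nsub.
have Nmem j : N (w j) by rewrite Nw; exact: span_of_mem.
pose x (l : 'I_m + 'I_k) : {poly R}^o :=
  match l with inl j => f j | inr j => rVpoly (w j) end.
apply: (@fin_generated_by _ _ _ _ x) => // [[j|j]|q] /=.
- exact: If.
- exact: Nmem.
have [e] := ubnP (size q); elim: e => // e IHe in q *.
rewrite ltnS => sq Iq; have [sqD|Dsq] := leqP (size q) D.
  have [s qs] : span_of w (poly_rV q) by rewrite -Nw /N poly_rV_K.
  exists (fun l => match l with inl j => 0 | inr j => (s j)%:P end).
  rewrite big_sumType /= big1 ?add0r; last by move=> j _; rewrite scale0r.
  rewrite -{1}[q](poly_rV_K sqD) qs linear_sum.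
  by apply: eq_bigr => j _; rewrite linearZ /= -mul_polyC.
have [r qr] : (span_of c : set R^o) q`_(size q).-1.
  by rewrite -Jc; exists (size q).-1, q; split=> //; rewrite leqSpred.
(* The shift moves degree [D] to the top degree of [q], so [q'] loses the leading term; since
   [D < size q], the exponent is a true difference. *)
pose g j : {poly R} := (r j)%:P * 'X^((size q).-1 - D).
have Dq : (D <= (size q).-1)%N by rewrite -ltnS prednK ?(leq_trans _ Dsq).
pose q' := q - \sum_j g j * f j.
have Iq' : I q'.
  apply: ID => //; rewrite -mulN1r; apply: IM.
  exact: (submodule_sum (V := {poly R}^o)).
have sq' : (size q' < size q)%N.
  rewrite -[in ltnRHS](@prednK (size q)) ?(leq_trans _ Dsq) // ltnS.
  apply/leq_sizeP => i; rewrite leq_eqVlt => /orP[/eqP<-|qi].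
    rewrite coefB coef_sum qr; apply/eqP; rewrite subr_eq0; apply/eqP.
    apply: eq_bigr => j _; rewrite -mulrA coefCM coefXnM ltnNge leq_subr /=.
    by rewrite subKn // fD.
  rewrite coefB coef_sum [q`_i]nth_default; last first.
    by rewrite -[size q]prednK ?(leq_trans _ Dsq).
  rewrite big1 ?subr0 // => j _; rewrite -mulrA coefCM coefXnM.
  case: ifP => [_|/negbT]; first by rewrite mulr0.
  rewrite -leqNgt => _; rewrite nth_default ?mulr0 // (leq_trans (sf j)) //.
  by rewrite subnBA // ltn_subRL ltn_add2r.
have [s qs] := IHe _ (leq_trans sq' sq) Iq'.
exists (fun l => s l + match l with inl j => g j | inr j => 0 end).
rewrite -[LHS](subrK (\sum_j g j * f j)) -/q' qs.
under [RHS]eq_bigr do rewrite scalerDl.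
rewrite big_split /=; congr (_ + _); rewrite big_sumType /=.
by rewrite [X in _ + X]big1 ?addr0 // => j _; rewrite scale0r.
Qed.

(** An ideal of [S] is the image of its preimage, so generators of the preimage map to
    generators. *)
Lemma noetherian_surj (R S : comNzRingType) (f : {rmorphism R -> S}) :
  (forall s, exists r, f r = s) -> noetherian R -> noetherian S.
Proof.
move=> fsurj Rnoeth I Isub; have /submoduleP[I0 ID IM] := Isub.
have [|n [x Jx]] := Rnoeth (fun r => I (f r)).
  apply/submoduleP; split=> [|r s Ir Is|r s Is].
  - by rewrite rmorph0.
  - by rewrite rmorphD; apply: ID.
  - by rewrite rmorphM; apply: IM.
apply: (@fin_generated_by _ _ _ _ (fun i => f (x i) : S^o)) => // [j|s Is].
  by have := span_of_mem (V := R^o) x j; rewrite -Jx.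
have [r rs] := fsurj s.
have [c rc] : (span_of x : set R^o) r by rewrite -Jx rs.
exists (f \o c); rewrite -rs rc rmorph_sum.
by apply: eq_bigr => i _; rewrite rmorphM.
Qed.

(** * Ring extensions with a finite dual basis *)

(** For a ring morphism [h], this is the dual basis criterion for [C] to be a finitely generated
    projective [B]-module. Linearity is written through [h], since [C] carries no [B]-module
    structure here. *)
Definition has_dual_basis (B C : comNzRingType) (h : B -> C) : Prop :=
  exists (L : finType) (co : L -> C -> B) (e : L -> C),
    [/\ forall l, {morph co l : x y / x + y},
        forall l b c, co l (h b * c) = b * co l c &
        forall c, c = \sum_l h (co l c) * e l].

Lemma dual_basis_id (B : comNzRingType) : has_dual_basis (@id B).
Proof.
exists unit, (fun=> id), (fun=> 1); split=> // c.
by rewrite big_const /= card_unit /= addr0 mulr1.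
Qed.

Lemma dual_basis_comp (B C D : comNzRingType) (f : {rmorphism B -> C})
    (g : {rmorphism C -> D}) :
  has_dual_basis f -> has_dual_basis g -> has_dual_basis (g \o f).
Proof.
move=> [L [co [e [coD coM coK]]]] [L' [co' [e' [coD' coM' coK']]]].
exists (L * L')%type, (fun l d => co l.1 (co' l.2 d)),
  (fun l => g (e l.1) * e' l.2); split=> [l x y|l b c|d] /=.
- by rewrite coD' coD.
- by rewrite coM' coM.
rewrite {1}[d]coK' -(pair_bigA _ (fun i j => g (f (co i (co' j d))) *
  (g (e i) * e' j))) exchange_big; apply: eq_bigr => j _ /=.
rewrite {1}[co' j d]coK rmorph_sum mulr_suml.
by apply: eq_bigr => i _; rewrite rmorphM mulrA.
Qed.

(** Each [co l] is [B]-linear, so it turns a relation with coefficients [x j] from [B] into a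
    relation over [B]; expanding every [c j] along [e] recombines these. *)
Lemma dual_basis_syzygy (B C : comNzRingType) (h : {rmorphism B -> C}) n
    (x : 'I_n -> B) (c : 'I_n -> C) :
  has_dual_basis h -> \sum_j h (x j) * c j = 0 ->
  exists (L : finType) (y : L -> 'rV[B]_n) (d : L -> C),
    (forall l, \sum_j x j * y l 0 j = 0) /\
    (forall j, c j = \sum_l h (y l 0 j) * d l).
Proof.
move=> [L [co [e [coD coM coK]]]] xc0.
exists L, (fun l => \row_j co l (c j)), e; split=> [l|j]; last first.
  by rewrite {1}[c j]coK; apply: eq_bigr => l _; rewrite mxE.
have co0 : co l 0 = 0 by apply: (addrI (co l 0)); rewrite -coD !addr0.
have := congr1 (co l) xc0; rewrite co0 (big_morph _ (coD l) co0) => xl0.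
by rewrite -[RHS]xl0; apply: eq_bigr => j _; rewrite mxE coM.
Qed.

(** * Coherence of a union of Noetherian rings *)

Section CoherentColimit.
Variables (B : nat -> comNzRingType) (S : comNzRingType).
Variables (h : forall i, {rmorphism B i -> B i.+1}).
Variables (g : forall i, {rmorphism B i -> S}).
Hypothesis gh : forall i b, g i.+1 (h i b) = g i b.
Hypothesis h_dual : forall i, has_dual_basis (h i).

Lemma colimit_transition i k : (i <= k)%N ->
  exists hik : {rmorphism B i -> B k},
    (forall b, g k (hik b) = g i b) /\ has_dual_basis hik.
Proof.
move: k; apply: dirlim_ind => [|k _ [hik [ghik dhik]]].
  by exists idfun; split=> //; exact: dual_basis_id.
exists (h k \o hik); split=> [b /=|]; first by rewrite gh.
exact: dual_basis_comp.
Qed.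

Hypothesis g_surj : forall s, exists i b, s = g i b.

(** The lower bound [i] allows comparison with data already chosen at stage [i]. *)
Lemma colimit_common_stage i n (s : 'I_n -> S) :
  exists2 k, (i <= k)%N & exists b : 'I_n -> B k, forall j, s j = g k (b j).
Proof.
pose st j := projT1 (cid (g_surj (s j))).
have stP j : exists b, s j = g (st j) b by exact: projT2 (cid (g_surj (s j))).
pose k := maxn i (\max_j st j); exists k; first exact: leq_maxl.
suff /choice[b bE] : forall j, exists b, s j = g k b by exists b.
move=> j; have [b ->] := stP j.
have /colimit_transition[t [gt _]] : (st j <= k)%N.
  by rewrite leq_max (leq_bigmax j) orbT.
by exists (t b).
Qed.

Lemma coherent_colimit :
  (forall i, noetherian (B i)) -> (forall i, injective (g i)) -> coherent S.
Proof.
move=> B_noeth g_inj I Isub [n [x Ix]].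
have [i _ [x' x'E]] := colimit_common_stage 0 x.
pose phi (v : 'rV[S]_n) : S^o := \sum_j v 0 j *: (x j : S^o).
have phi_lin : linear phi.
  move=> r v w; rewrite /phi scaler_sumr -big_split; apply: eq_bigr => j _ /=.
  by rewrite !mxE scalerDl scalerA.
pose Phi : {linear 'rV[S]_n -> S^o} :=
  HB.pack phi (GRing.isLinear.Build _ _ _ _ phi phi_lin).
exists n, Phi; split.
  rewrite Ix; apply/seteqP; split=> [_ [v _ <-]|_ [c ->]].
    by exists (v 0).
  by exists (\row_j c j) => //=; apply: eq_bigr => j _; rewrite mxE.
(* These are the relations between the representatives [x'] over a Noetherian stage; generators of
   [K] will generate the kernel of [Phi]. *)
pose K : set 'rV[B i]_n := fun v => \sum_j x' j * v 0 j = 0.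
have Ksub : submodule K.
  rewrite /K; apply/submoduleP; split=> [|v w Kv Kw|r v Kv].
  - by rewrite big1 // => j _; rewrite mxE mulr0.
  - under eq_bigr do rewrite mxE mulrDr.
    by rewrite big_split /= Kv Kw addr0.
  - under eq_bigr do rewrite mxE mulrCA.
    by rewrite -mulr_sumr Kv mulr0.
have [m [w Kw]] := noetherian_row_submodule (B_noeth i) Ksub.
have Kmem j : K (w j) by rewrite Kw; exact: span_of_mem.
apply: (@fin_generated_by _ _ _ _ (fun l => map_mx (g i) (w l))).
- apply/submoduleP; split=> [|v u v0 u0|r v v0] /=.
  + exact: (linear0 Phi).
  + by apply: etrans (linearD Phi v u) _; rewrite [Phi v]v0 [Phi u]u0 addr0.
  + have PhiZ : Phi (r *: v) = r *: Phi v by rewrite linearZ_LR.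
    by rewrite [LHS]PhiZ [Phi v]v0 scaler0.
- move=> l; rewrite /= /phi -[RHS](rmorph0 (g i)) -(Kmem l) rmorph_sum.
  by apply: eq_bigr => j _; rewrite mxE rmorphM x'E mulrC.
(* The entries of [v] may need a later stage [k]; injectivity of [g k] makes [v] a relation
   there. *)
move=> v /= v0; have [k ik [c cE]] := colimit_common_stage i (v 0).
have [t [gt dt]] := colimit_transition ik.
have tc0 : \sum_j t (x' j) * c j = 0.
  apply: (g_inj k); rewrite rmorph0 -[RHS]v0 rmorph_sum.
  by apply: eq_bigr => j _; rewrite rmorphM gt -x'E -cE mulrC.
have [L [y [d [y0 yE]]]] := dual_basis_syzygy dt tc0.
have /choice[s sE] : forall l, exists s : 'I_m -> B i, y l = \sum_j s j *: w j.
  by move=> l; have : K (y l) := y0 l; rewrite Kw.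
(* In [S], [v] combines the [y l] with coefficients [d l], and [y l] combines the [w j] with
   coefficients [s l j]. *)
exists (fun j => \sum_l g i (s l j) * g k (d l)).
apply/rowP => j; rewrite cE yE rmorph_sum summxE.
under [RHS]eq_bigr do rewrite !mxE mulr_suml.
rewrite exchange_big; apply: eq_bigr => l _ /=.
rewrite rmorphM gt sE summxE rmorph_sum mulr_suml; apply: eq_bigr => r _.
by rewrite mxE rmorphM mulrAC.
Qed.

End CoherentColimit.

(** * Polynomials as a module over polynomials in ['X^p] *)

Section Decimation.
Variables (R : comNzRingType) (p : nat) (p_gt0 : (0 < p)%N).

(** For [u < p], the coordinate of [q] on ['X^u] over the polynomials in ['X^p]. The crude bound
    [size q] is enough because [j <= j * p + u]. *)
Definition decimate (u : nat) (q : {poly R}) : {poly R} :=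
  \poly_(j < size q) q`_(j * p + u).

Lemma coef_decimate u q j : (decimate u q)`_j = q`_(j * p + u).
Proof.
rewrite coef_poly; case: ltnP => // qj; rewrite nth_default //.
by rewrite (leq_trans qj) // (leq_trans _ (leq_addr _ _)) // leq_pmulr.
Qed.

Lemma decimateD u : {morph decimate u : q r / q + r}.
Proof. by move=> q r; apply/polyP => j; rewrite coefD !coef_decimate coefD. Qed.

(** Induction on [b]: multiplying by ['X^p] shifts the decimated polynomial by one degree, and for
    [u < p] leaves its constant coefficient zero. *)
Lemma decimateM u (b q : {poly R}) : (u < p)%N ->
  decimate u ((b \Po 'X^p) * q) = b * decimate u q.
Proof.
move=> up; elim/poly_ind: b q => [|b c IH] q.
  by rewrite comp_poly0 !mul0r; apply/polyP=> j; rewrite coef_decimate !coef0.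
rewrite comp_poly_MXaddC mulrDl decimateD -mulrA IH mulrDl -mulrA.
congr (b * _ + _); apply/polyP => j; rewrite coef_decimate.
  rewrite coefXnM coefXM; case: j => [|j] /=; first by rewrite mul0n up.
  by rewrite mulSn -addnA ltnNge leq_addr addKn coef_decimate.
by rewrite !coefCM coef_decimate.
Qed.

Lemma decimate1 : decimate 0 1 = 1.
Proof.
apply/polyP => j; rewrite coef_decimate addn0 !coef1 muln_eq0.
by rewrite [p == 0%N]eqn0Ngt p_gt0 orbF.
Qed.

Lemma decimateK (q : {poly R}) :
  q = \sum_(u < p) (decimate u q \Po 'X^p) * 'X^u.
Proof.
apply/polyP => n; rewrite coef_sum.
(* Only the residue of [n] modulo [p] contributes in degree [n]. *)
pose u0 := Ordinal (ltn_pmod n p_gt0).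
rewrite (bigD1 u0) //= coefMXn ltnNge leq_mod /= coef_comp_poly_Xn //.
have -> : (n - n %% p = n %/ p * p)%N by rewrite {1}(divn_eq n p) addnK.
rewrite dvdn_mull // mulnK // coef_decimate -divn_eq big1 ?addr0 // => u.
move=> uu0; rewrite coefMXn; case: ltnP => // le_un.
rewrite coef_comp_poly_Xn //; case: ifP => //; rewrite -eqn_mod_dvd //.
by move/eqP => nu; case/eqP: uu0; apply: val_inj; rewrite /= nu modn_small.
Qed.

(** [decimate 0] is a left inverse. *)
Lemma comp_polyXn_inj : injective (comp_poly ('X^p : {poly R})).
Proof.
move=> q r e; have := decimateM q 1 p_gt0; rewrite mulr1 e -[r \Po _]mulr1.
by rewrite decimateM // decimate1 !mulr1.
Qed.

Lemma comp_polyXn_dual_basis :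
  has_dual_basis (comp_poly ('X^p : {poly R})).
Proof.
exists 'I_p, (fun u : 'I_p => decimate u), (fun u : 'I_p => 'X^u).
split=> [u|u b c|c].
- exact: decimateD.
- exact: decimateM.
- exact: decimateK.
Qed.

End Decimation.

(** Coordinates act coefficientwise, and the [e l] become constants. *)
Lemma map_poly_dual_basis (B C : comNzRingType) (h : {rmorphism B -> C}) :
  has_dual_basis h ->
  has_dual_basis (map_poly h : {poly B} -> {poly C}).
Proof.
move=> [L [co [e [coD coM coK]]]].
have co0 l : co l 0 = 0 by apply: (addrI (co l 0)); rewrite -coD !addr0.
have coef_co l q i : (map_poly (co l) q)`_i = co l q`_i.
  exact: coef_map_id0.
exists L, (fun l => map_poly (co l)), (fun l => (e l)%:P).
split=> [l q r|l b q|q].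
- by apply/polyP => i; rewrite coefD !coef_co coefD coD.
- apply/polyP => i; rewrite coef_co !coefM.
  rewrite (big_morph _ (coD l) (co0 l)); apply: eq_bigr => j _.
  by rewrite coef_co coef_map coM.
- apply/polyP => i; rewrite coef_sum [LHS]coK; apply: eq_bigr => l _.
  by rewrite coefMC coef_map coef_co.
Qed.

(** Equality in the limit is equality at a later stage, and injective steps bring it back to stage
    [i]. *)
Lemma dirlim_in_inj (R : nat -> comNzRingType)
    (f : forall i, {rmorphism R i -> R i.+1}) i :
  (forall i, injective (f i)) -> injective (@dirlim_in R f i).
Proof.
move=> f_inj x y /dirlim_in_eq[n [le_in]].
move: n le_in; apply: dirlim_ind => [|n le_in IH].
  by rewrite !dirlim_pushE.
by rewrite !dirlim_pushS // => /f_inj.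
Qed.

(** * Adjoining the next [p]-th root of [a] *)

Section Root.
Variables (A : comNzRingType) (a : A) (p : nat) (p_gt1 : (1 < p)%N).

Local Notation root_step := (@root_step A a p p_gt1).
Local Notation root_poly := (root_poly a p).
Let p_gt0 : (0 < p)%N := ltnW p_gt1.

Lemma in_qpoly_val i (q : root_ring a p i) :
  in_qpoly (root_poly i) (q : {poly A}) = q.
Proof. by apply: val_inj; apply: in_qpoly_small; exact: size_mk_monic. Qed.

Lemma in_qpoly_root_poly i : in_qpoly (root_poly i) (root_poly i) = 0.
Proof.
apply: val_inj => /=; rewrite mk_monic_root_poly // -{1}[root_poly i]mul1r.
by rewrite Pdiv.RingMonic.rmodp_mull // monicXnsubC // expn_gt0 p_gt0.
Qed.

Definition root_decimate i u (c : root_ring a p i.+1) : root_ring a p i :=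
  in_qpoly (root_poly i) (decimate p u c).

(** Any representative may be decimated: [root_poly i.+1] is [root_poly i] composed with ['X^p], so
    by [decimateM] its multiples decimate to multiples of [root_poly i]. *)
Lemma root_decimate_in_qpoly i u (q : {poly A}) : (u < p)%N ->
  root_decimate u (in_qpoly (root_poly i.+1) q) =
  in_qpoly (root_poly i) (decimate p u q).
Proof.
move=> up.
rewrite [in RHS](Pdiv.RingMonic.rdivp_eq (monic_mk_monic (root_poly i.+1)) q).
rewrite /root_decimate decimateD // rmorphD /= mk_monic_root_poly //.
rewrite -[X in _ * X]root_poly_step mulrC decimateM // rmorphM /=.
by rewrite in_qpoly_root_poly mul0r add0r.
Qed.

Lemma root_decimateM i u (b : root_ring a p i) (c : root_ring a p i.+1) :
  (u < p)%N -> root_decimate u (root_step b * c) = b * root_decimate u c.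
Proof.
move=> up; rewrite -{1}[b]in_qpoly_val -{1}[c]in_qpoly_val.
rewrite root_step_in_qpoly -rmorphM root_decimate_in_qpoly //.
by rewrite decimateM // rmorphM /= in_qpoly_val.
Qed.

(** Again the coordinate at [u = 0] is a left inverse. *)
Lemma root_step_inj i : injective (@root_step i).
Proof.
move=> q r e; have := root_decimateM q 1 p_gt0.
rewrite e root_decimateM // -(rmorph1 (in_qpoly (root_poly i.+1))).
by rewrite root_decimate_in_qpoly // decimate1 // rmorph1 !mulr1.
Qed.

(** The basis is formed by the powers a^(u/p^(i+1)) with [u < p]. *)
Lemma root_step_dual_basis i : has_dual_basis (@root_step i).
Proof.
exists 'I_p, (fun u : 'I_p => root_decimate u),
  (fun u : 'I_p => in_qpoly (root_poly i.+1) 'X^u); split=> [u x y|u b c|c].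
- by rewrite /root_decimate -rmorphD -decimateD.
- exact: root_decimateM.
rewrite -{1}[c]in_qpoly_val {1}[c : {poly A}](decimateK p_gt0) rmorph_sum.
by apply: eq_bigr => u _; rewrite rmorphM /= -root_step_in_qpoly.
Qed.

End Root.

(** * The ring as the union of its Noetherian stages *)

Theorem proposition7p5 (p : nat) (hp : (1 < p)%N) (A : topComRingType) (a : A)
    (A_noeth : noetherian A) (A_adm : admissible A)
    (a_ideal : max_ideal_of_definition (principal a))
    (a_no_root : forall (i : nat) (b : A), (0 < i)%N -> b ^+ (p ^ i)%N <> a) :
  coherent (perf_poly (eka a hp) p).
Proof.
have p_gt0 : (0 < p)%N := ltnW hp.
pose B i : comNzRingType := {poly root_ring a p i}.
pose step i : {rmorphism root_ring a p i -> root_ring a p i.+1} :=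
  @root_step A a p hp i.
(* Both kinds of roots advance together: [step i] handles those of [a], composition with ['X^p]
   those of T. *)
pose h i : {rmorphism B i -> B i.+1} :=
  comp_poly ('X^p : B i.+1) \o map_poly (step i).
pose P (i : nat) : comNzRingType := {poly eka a hp}.
pose F (i : nat) : {rmorphism P i -> P i.+1} := comp_poly ('X^p : P i).
pose g i : {rmorphism B i -> perf_poly (eka a hp) p} :=
  @dirlim_in P F i \o map_poly (@dirlim_in _ step i).
apply: (@coherent_colimit B _ h g) => [i b|i|s|i|i].
- rewrite /= map_comp_poly map_polyXn.
  rewrite (dirlim_in_step F); congr dirlim_in.
  by apply/polyP => j; rewrite !coef_map /= (dirlim_in_step step).
- apply: dual_basis_comp; last exact: comp_polyXn_dual_basis.
  by apply: map_poly_dual_basis; exact: root_step_dual_basis.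
- have [i [q ->]] := dirlim_in_surj s.
  have [|x|n i_n [c cE]] := @colimit_common_stage _ _ step
      (fun i => @dirlim_in _ step i) (@dirlim_in_step _ step) _ _ i _
      (fun j : 'I_(size q) => q`_j).
  + by move=> k; exact: root_step_dual_basis.
  + exact: dirlim_in_surj.
  pose r : B n := \sum_j (c j)%:P * 'X^j.
  have rq : map_poly (@dirlim_in _ step n) r = q.
    rewrite -[RHS]coefK poly_def rmorph_sum; apply: eq_bigr => j _.
    by rewrite rmorphM /= map_polyC map_polyXn cE mul_polyC.
  (* In [B n] one index governs the roots of [a] and of T, so [q] is pushed from stage [i] to stage
     [n]; composing with ['X^p] keeps its coefficients in the image of [root_ring a p n]. *)
  have push_q : forall m, (i <= m)%N -> exists r' : B n,
      map_poly (@dirlim_in _ step n) r' = dirlim_push F (@Tagged nat i P q) m.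
    apply: dirlim_ind => [|m i_m [r' r'E]].
      by exists r; rewrite dirlim_pushE.
    exists (r' \Po 'X^p); rewrite dirlim_pushS // -r'E.
    by rewrite map_comp_poly map_polyXn.
  have [r' r'E] := push_q n i_n.
  by exists n, r'; rewrite /= r'E dirlim_in_push.
(* Hilbert's theorem serves twice: for the variable T, and for [{poly A}], of which the root ring is
   a quotient. *)
- apply: noetherian_poly.
  apply: (@noetherian_surj {poly A} _ (in_qpoly (root_poly a p i))).
    by move=> q; exact: ex_intro (in_qpoly_val q).
  exact: noetherian_poly.
- apply: inj_comp.
    by apply: dirlim_in_inj => ?; exact: comp_polyXn_inj.
  apply: map_inj_poly; last exact: rmorph0.
  by apply: dirlim_in_inj => ?; exact: root_step_inj.
Qed.
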